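(* Let $A$ be a nonzero unital associative ring, $G$ a group, $\sigma : G \to \operatorname{Aut}(A)$ a group homomorphism, and $A \rtimes_\sigma G$ the associated skew group ring. Consider the following three assertions: (i) $A \rtimes_\sigma G$ is a simple ring; (ii) $A$ is $G$-simple and the centre $Z(A \rtimes_\sigma G)$ is a field; (iii) $A$ is $G$-simple and $\sigma : G \to \operatorname{Aut}(A)$ is injective. The following conclusions hold: (a) (i) implies (ii) and (iii); (b) in general (ii) and (iii) do not imply (i), i.e. there exist $A$, $G$ and $\sigma$ for which (ii) and (iii) both hold but (i) fails; (c) if $G$ is an abelian group, then (i) is equivalent to (ii); (d) if $G$ is an abelian group and $A$ is a commutative ring, then (i), (ii) and (iii) are all equivalent.
   Context: $G$ is written multiplicatively with neutral element $e$. The skew group ring $A \rtimes_\sigma G$ is the free left $A$-module with basis $\{u_g\}_{g\in G}$ (a copy of $G$), with multiplication the biadditive extension of $(a u_g)(b u_h) = a\,\sigma_g(b)\, u_{gh}$ for $a,b\in A$, $g,h\in G$, where $\sigma_g := \sigma(g)$. It is a unital associative ring with identity $1_A u_e$, and $A$ is identified with the subring $A u_e$. An ideal means a two-sided ideal. An ideal $I$ of $A$ is $G$-invariant if $\sigma_g(I)\subseteq I$ for all $g\in G$; $A$ is $G$-simple if $\{0\}$ and $A$ are the only $G$-invariant ideals of $A$. $Z(T)$ denotes the centre of a ring $T$. A simple ring is a nonzero ring whose only two-sided ideals are $\{0\}$ and the whole ring. *)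

(* Defs.v *)
From HB Require Import structures.
From mathcomp Require Import all_boot all_algebra finmap.
From mathcomp.multinomials Require Import monalg.
From mathcomp Require Import boolp classical_sets.

Set Implicit Arguments.
Unset Strict Implicit.
Unset Printing Implicit Defensive.

Import GRing.Theory.
Local Open Scope classical_set_scope.
Local Open Scope ring_scope.

Section Rings.
Variable T : pzRingType.

Definition ideal (I : set T) : Prop :=
  [/\ I 0,
      forall x y, I x -> I y -> I (x - y)
    & forall a x, I x -> I (a * x) /\ I (x * a)].

Definition simple_ring : Prop :=
  (1 : T) <> 0 /\ forall I : set T, ideal I -> I = [set 0] \/ I = setT.

Definition central : {pred T} := fun z => `[< forall x : T, z * x = x * z >].

Lemma centralP z : reflect (forall x : T, z * x = x * z) (z \in central).
Proof. exact: asboolP. Qed.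

Lemma central_subring_closed : subring_closed central.
Proof.
split=> [|y z /centralP cy /centralP cz|y z /centralP cy /centralP cz].
- by apply/centralP => x; rewrite mul1r mulr1.
- by apply/centralP => x; rewrite mulrBl mulrBr cy cz.
- by apply/centralP => x; rewrite -mulrA cz mulrA cy mulrA.
Qed.

Record centre : Type := Centre { centre_val : T; _ : centre_val \in central }.

HB.instance Definition _ := [isSub for centre_val].
HB.instance Definition _ := [Choice of centre by <:].
HB.instance Definition _ :=
  GRing.SubChoice_isSubPzRing.Build T central centre central_subring_closed.

Lemma centre_mulC : commutative (@GRing.mul centre).
Proof.
move=> y z; apply: val_inj; rewrite !rmorphM /=.
by case: y => y /= /centralP; apply.
Qed.

HB.instance Definition _ :=
  GRing.PzRing_hasCommutativeMul.Build centre centre_mulC.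

End Rings.

Definition is_field (R : comPzRingType) : Prop :=
  (1 : R) <> 0 /\ forall x : R, x <> 0 -> exists y : R, x * y = 1.

Section RingAut.
Variable A : pzRingType.

Definition ring_aut_pred (f : A -> A) : Prop :=
  [/\ zmod_morphism f, monoid_morphism f & bijective f].

Record ring_aut : Type :=
  RingAut { aut_fun :> A -> A; aut_funP : `[< ring_aut_pred aut_fun >] }.

HB.instance Definition _ := [isSub for aut_fun].
HB.instance Definition _ := [Choice of ring_aut by <:].

Implicit Types s t u : ring_aut.

Lemma ring_autP s t : (forall a, s a = t a) -> s = t.
Proof. by move=> st; apply: val_inj; apply: funext. Qed.

Lemma aut_zmod_morphism s : zmod_morphism s.
Proof. by case: s => f /= /asboolP[]. Qed.

Lemma aut_monoid_morphism s : monoid_morphism s.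
Proof. by case: s => f /= /asboolP[]. Qed.

Lemma aut_bij s : bijective s.
Proof. by case: s => f /= /asboolP[]. Qed.

HB.instance Definition _ s :=
  GRing.isZmodMorphism.Build A A s (aut_zmod_morphism s).
HB.instance Definition _ s :=
  GRing.isMonoidMorphism.Build A A s (aut_monoid_morphism s).

Lemma aut_one_subproof : `[< ring_aut_pred (@idfun A) >].
Proof. by apply/asboolP; split=> //; exists id. Qed.

Lemma aut_mul_subproof s t : `[< ring_aut_pred (s \o t) >].
Proof.
apply/asboolP; split; last exact: bij_comp (aut_bij s) (aut_bij t).
- by move=> x y /=; rewrite !rmorphB.
- by split=> [|x y] /=; rewrite ?rmorph1 ?rmorphM.
Qed.

Lemma aut_inv_subproof s : {g : A -> A | cancel s g & cancel g s}.
Proof.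
by apply: cid2; case: (aut_bij s) => g sK gK; exists g.
Qed.

Definition aut_inv_fun s : A -> A := s2val (aut_inv_subproof s).

Lemma aut_funK s : cancel s (aut_inv_fun s).
Proof. exact: (s2valP (aut_inv_subproof s)). Qed.

Lemma aut_inv_funK s : cancel (aut_inv_fun s) s.
Proof. exact: (s2valP' (aut_inv_subproof s)). Qed.

Lemma aut_inv_pred s : `[< ring_aut_pred (aut_inv_fun s) >].
Proof.
have sI := bij_inj (aut_bij s); have sK := aut_inv_funK s.
apply/asboolP; split; last by exists s => //; exact: aut_funK.
- by move=> x y; apply: sI; rewrite rmorphB /= !sK.
- by split=> [|x y]; apply: sI; rewrite ?rmorph1 ?rmorphM /= !sK.
Qed.

Definition aut_one : ring_aut := RingAut aut_one_subproof.
Definition aut_mul s t : ring_aut := RingAut (aut_mul_subproof s t).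
Definition aut_inv s : ring_aut := RingAut (aut_inv_pred s).

Lemma aut_mulA : associative aut_mul.
Proof. by move=> s t u; apply: ring_autP. Qed.
Lemma aut_mul1 : left_id aut_one aut_mul.
Proof. by move=> s; apply: ring_autP. Qed.
Lemma aut_mulr1 : right_id aut_one aut_mul.
Proof. by move=> s; apply: ring_autP. Qed.
Lemma aut_mulV : left_inverse aut_one aut_inv aut_mul.
Proof. by move=> s; apply: ring_autP => a /=; rewrite aut_funK. Qed.
Lemma aut_mulrV : right_inverse aut_one aut_inv aut_mul.
Proof. by move=> s; apply: ring_autP => a /=; rewrite aut_inv_funK. Qed.

HB.instance Definition _ := isGroup.Build ring_aut
  aut_mulA aut_mul1 aut_mulr1 aut_mulV aut_mulrV.

Lemma aut1E a : (1%g : ring_aut) a = a. Proof. by []. Qed.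
Lemma autME s t a : (s * t)%g a = s (t a). Proof. by []. Qed.

End RingAut.

Notation group_hom G H := (monoid.UMagmaMorphism.type G H).

Section GSimple.
Variables (A : pzRingType) (G : groupType) (sigma : group_hom G (ring_aut A)).

Definition G_invariant (I : set A) : Prop :=
  forall g : G, sigma g @` I `<=` I.

Definition G_simple : Prop :=
  forall I : set A, ideal I -> G_invariant I -> I = [set 0] \/ I = setT.

End GSimple.

(* [{malg A[G]}] is the free left A-module on the set G; its basis vector u_g
   is [<< g >>] and [a u_g] is [<< a *g g >>]. *)
Definition skew_group_ring (A : nzRingType) (G : groupType)
  (sigma : group_hom G (ring_aut A)) : Type := {malg A[G]}.

Section SkewGroupRing.
Variables (A : nzRingType) (G : groupType) (sigma : group_hom G (ring_aut A)).

Local Notation S := (skew_group_ring sigma).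

HB.instance Definition _ := GRing.Lmodule.copy S {malg A[G]}.

Implicit Types (x y z : S) (g h k : G).

Definition skew_one : S := << 1%g >>.

Definition skew_mul x y : S :=
  \sum_(g <- msupp x) \sum_(h <- msupp y) << x@_g * sigma g y@_h *g (g * h)%g >>.

Lemma skew_mulw (d1 d2 : {fset G}) x y :
  fsubset (msupp x) d1 -> fsubset (msupp y) d2 ->
  skew_mul x y =
    \sum_(g <- d1) \sum_(h <- d2) << x@_g * sigma g y@_h *g (g * h)%g >>.
Proof.
move=> le1 le2; rewrite /skew_mul (big_fset_incl _ le1) /=.
  apply/eq_bigr => g _; apply/big_fset_incl => // h _ /mcoeff_outdom ->.
  by rewrite rmorph0 mulr0 monalgU0.
move=> g _ /mcoeff_outdom xg.
by rewrite big1 // => h _; rewrite xg mul0r monalgU0.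
Qed.

Lemma skew_mulUU a b g h :
  skew_mul << a *g g >> << b *g h >> = << a * sigma g b *g (g * h)%g >>.
Proof. by rewrite (skew_mulw msuppU_le msuppU_le) !big_seq_fset1 !mcoeffUU. Qed.

Lemma skew_mulDl : left_distributive skew_mul +%R.
Proof.
move=> x y z; set d := fsetU (msupp x) (msupp y).
have dx : fsubset (msupp x) d by exact: fsubsetUl.
have dy : fsubset (msupp y) d by exact: fsubsetUr.
have dxy : fsubset (msupp (x + y)) d by exact: msuppD_le.
have dz := fsubset_refl (msupp z).
rewrite (skew_mulw dxy dz) (skew_mulw dx dz) (skew_mulw dy dz).
rewrite -big_split /=; apply/eq_bigr => g _.
rewrite -big_split /=; apply/eq_bigr => h _.
by rewrite mcoeffD mulrDl monalgUD.
Qed.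

Lemma skew_mulDr : right_distributive skew_mul +%R.
Proof.
move=> z x y; set d := fsetU (msupp x) (msupp y).
have dx : fsubset (msupp x) d by exact: fsubsetUl.
have dy : fsubset (msupp y) d by exact: fsubsetUr.
have dxy : fsubset (msupp (x + y)) d by exact: msuppD_le.
have dz := fsubset_refl (msupp z).
rewrite (skew_mulw dz dxy) (skew_mulw dz dx) (skew_mulw dz dy).
rewrite -big_split /=; apply/eq_bigr => g _.
rewrite -big_split /=; apply/eq_bigr => h _.
by rewrite mcoeffD rmorphD mulrDr monalgUD.
Qed.

Lemma skew_mul0 y : skew_mul 0 y = 0.
Proof. by rewrite /skew_mul msupp0 big_seq_fset0. Qed.

Lemma skew_mulr0 x : skew_mul x 0 = 0.
Proof. by rewrite /skew_mul big1 // => g _; rewrite msupp0 big_seq_fset0. Qed.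

Lemma skew_mul_suml (I : Type) (r : seq I) (F : I -> S) y :
  skew_mul (\sum_(i <- r) F i) y = \sum_(i <- r) skew_mul (F i) y.
Proof.
exact: (big_morph (skew_mul^~ y) (fun a b => skew_mulDl a b y) (skew_mul0 y)).
Qed.

Lemma skew_mul_sumr (I : Type) (r : seq I) (F : I -> S) x :
  skew_mul x (\sum_(i <- r) F i) = \sum_(i <- r) skew_mul x (F i).
Proof.
exact: (big_morph (skew_mul x) (fun a b => skew_mulDr x a b) (skew_mulr0 x)).
Qed.

Lemma skewE x : x = \sum_(g <- msupp x) (<< x@_g *g g >> : S).
Proof. exact: monalgE. Qed.

Lemma skew_mul1 : left_id skew_one skew_mul.
Proof.
move=> x; rewrite [RHS]skewE {1}(skewE x) skew_mul_sumr; apply: eq_bigr => g _.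
by rewrite skew_mulUU gmulf1 aut1E mul1r mul1g.
Qed.

Lemma skew_mulr1 : right_id skew_one skew_mul.
Proof.
move=> x; rewrite [RHS]skewE {1}(skewE x) skew_mul_suml; apply: eq_bigr => g _.
by rewrite skew_mulUU rmorph1 mulr1 mulg1.
Qed.

Lemma skew_mulA : associative skew_mul.
Proof.
move=> x y z; rewrite (skewE x) !skew_mul_suml; apply: eq_bigr => g _.
rewrite (skewE y) !(skew_mul_suml, skew_mul_sumr); apply: eq_bigr => h _.
rewrite (skewE z) !skew_mul_sumr; apply: eq_bigr => k _.
by rewrite !skew_mulUU rmorphM gmulfM autME mulrA mulgA.
Qed.

Lemma skew_oner_neq0 : skew_one != 0.
Proof. by rewrite monalgU_eq0 oner_eq0. Qed.

HB.instance Definition _ := GRing.Zmodule_isNzRing.Build S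
  skew_mulA skew_mul1 skew_mulr1 skew_mulDl skew_mulDr skew_oner_neq0.

Lemma skewM_UU a b g h :
  (<< a *g g >> : S) * << b *g h >> = << a * sigma g b *g (g * h)%g >>.
Proof. exact: skew_mulUU. Qed.

End SkewGroupRing.

(* Main.v *)
Require Import Defs.
From mathcomp Require Import all_boot all_algebra.
From HB Require Import structures.
From mathcomp Require Import finmap.
From mathcomp.multinomials Require Import monalg.
From mathcomp Require Import boolp classical_sets cardinality.
From mathcomp Require Import ring.

Set Implicit Arguments.
Unset Strict Implicit.
Unset Printing Implicit Defensive.

Import GRing.Theory Num.Theory.
Local Open Scope classical_set_scope.
Local Open Scope ring_scope.

(** Why the theorem is true.  Write S for the skew group ring and z_g for the
    coefficient of z at u_g.

    From simplicity of S: if I is a G-invariant ideal of A, the elements with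
    all coefficients in I form an ideal of S, so A is G-simple
    ([simple_skew_G_simple]); the multiples of a central element form an
    ideal, so the centre is a field ([simple_centre_field]).  For injectivity
    of sigma, note that S acts on A by (a u_g).b = a sigma_g(b), and that the
    annihilator of a nonzero module over a simple ring is zero; but u_g - u_h
    acts as zero when sigma_g = sigma_h ([simple_skew_injective]).

    To simplicity of S, for G abelian: take a nonzero ideal J and a nonzero x
    in J of least support size.  The elements of J supported in the support of
    x are stable under conjugation by the u_h (this is where commutativity of
    G enters), so their coefficients at a fixed g in that support form a
    nonzero G-invariant ideal of A, and some y among them has y_g = 1.  The
    differences between y and its conjugates, and between a y and its
    counterpart on the right, lose the coefficient at g, hence vanish by
    minimality.  Then y u_g^-1 is a central element of J with coefficient 1 at
    the identity ([abelian_ideal_central]).  If the centre is a field, this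
    element is invertible and J = S ([abelian_simple]).  If instead A is
    commutative and sigma injective, each coefficient c = y_h of a central y
    is sigma-fixed, hence zero or invertible, and a c = c sigma_h(a) forces
    sigma_h = 1, hence h = 1, in the second case: so y = 1
    ([abelian_commutative_simple]).

    The counterexample: let G act on A by conjugation through a homomorphism
    rho from G to the units of A.  Then S also acts on A by
    (a u_g).b = a rho(g) b, and rho(g^-1) u_g - 1 acts as zero, so S is not
    simple as soon as G is nontrivial ([inner_not_simple]).  On the other hand
    the coefficients of a central element are, up to sigma, constant on
    conjugacy classes; if all nontrivial classes are infinite, the centre of S
    lies in A and is a field when A is G-simple ([icc_centre_field]).  The
    group of maps x |-> a x + b of the rational line has infinite nontrivial
    classes and embeds in the invertible 2 x 2 rational matrices with no
    nontrivial scalars in its image, so it acts faithfully by conjugation on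
    the simple ring of 2 x 2 matrices. *)

(** * Ideals and centres *)

Section IdealTheory.
Variable T : pzRingType.
Implicit Types (I : set T) (x y z : T).

Lemma idealN I x : ideal I -> I x -> I (- x).
Proof. by case=> I0 IB _ Ix; rewrite -sub0r; apply: IB. Qed.

Lemma idealD I x y : ideal I -> I x -> I y -> I (x + y).
Proof.
move=> idI Ix Iy; rewrite -[y]opprK; case: (idI) => _ IB _.
by apply: IB => //; apply: idealN.
Qed.

Lemma idealMl I a x : ideal I -> I x -> I (a * x).
Proof. by case=> _ _ IM /(IM a)[]. Qed.

Lemma idealMr I a x : ideal I -> I x -> I (x * a).
Proof. by case=> _ _ IM /(IM a)[]. Qed.

Lemma ideal_sum I (J : Type) (r : seq J) (F : J -> T) :
  ideal I -> (forall j, I (F j)) -> I (\sum_(j <- r) F j).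
Proof.
by move=> idI IF; apply: big_ind => //; [case: idI | move=> ? ?; apply: idealD].
Qed.

Lemma ideal1_setT I : ideal I -> I 1 -> I = setT.
Proof.
case=> _ _ IM I1; apply/seteqP; split=> // x _.
by rewrite -(mulr1 x); case: (IM x 1 I1).
Qed.

Lemma ideal_neq0P I : ideal I -> I <> [set 0] -> exists2 x, I x & x <> 0.
Proof.
case=> I0 _ _ In0; apply: contrapT => noI; apply: In0; apply/seteqP.
split=> [x Ix|_ -> //]; apply: contrapT => x0; apply: noI; by exists x.
Qed.

Lemma multiples_ideal c : (forall x, c * x = x * c) ->
  ideal [set x | exists y, x = c * y].
Proof.
move=> cC; split; first by exists 0; rewrite mulr0.
  by move=> _ _ [y ->] [z ->]; exists (y - z); rewrite mulrBr.
move=> a _ [y ->]; split; first by exists (a * y); rewrite mulrA -cC mulrA.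
by exists (y * a); rewrite mulrA.
Qed.

(** An inverse of a central element is itself central, so it suffices to find
    inverses in the ambient ring. *)
Lemma centre_is_field :
  (1 : T) <> 0 ->
  (forall z, (forall x, z * x = x * z) -> z <> 0 -> exists y, z * y = 1) ->
  is_field (centre T).
Proof.
move=> T1 inv; split=> [/(congr1 val) //|z z0].
have zC : forall x, val z * x = x * val z by apply/centralP; case: (z).
have [|y zy] := inv _ zC; first by move=> vz; apply/z0/val_inj.
have yC : y \in @central T.
  apply/centralP=> x; rewrite -[LHS]mulr1 -zy mulrA -(mulrA y x) -zC.
  by rewrite mulrA -zC zy mul1r.
by exists (Centre yC); apply: val_inj.
Qed.

Lemma centre_inverse z : is_field (centre T) ->
  (forall x, z * x = x * z) -> z <> 0 -> exists y, z * y = 1.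
Proof.
move=> [_ inv] /centralP zC z0.
have [|y /(congr1 val) zy] := inv (Centre zC); first by move=> /(congr1 val).
by exists (val y).
Qed.

(** The multiples of a nonzero central element form a nonzero ideal. *)
Lemma simple_centre_field : simple_ring T -> is_field (centre T).
Proof.
move=> [T1 simp]; apply: centre_is_field => // z zC z0.
have [J0|JT] := simp _ (multiples_ideal zC).
  suff : [set x | exists y, x = z * y] z by rewrite J0.
  by exists 1; rewrite mulr1.
have : [set x | exists y, x = z * y] 1 by rewrite JT.
by case=> y ->; exists y.
Qed.

End IdealTheory.

(** * Coefficients in a skew group ring *)

Section SkewCoefficients.
Variables (A : nzRingType) (G : groupType) (sigma : group_hom G (ring_aut A)).
Local Notation S := (skew_group_ring sigma).
Implicit Types (x y z : S) (a b c : A) (g h k : G).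

Lemma skew1E : (1 : S) = << 1 *g 1%g >>.
Proof. by []. Qed.

Lemma sigma1E a : sigma 1%g a = a.
Proof. by rewrite gmulf1. Qed.

Lemma sigmaM g h a : sigma (g * h)%g a = sigma g (sigma h a).
Proof. by rewrite gmulfM. Qed.

Lemma sigmaK g : cancel (sigma g) (sigma g^-1%g).
Proof. by move=> a; rewrite -sigmaM mulVg sigma1E. Qed.

Lemma sigmaVK g : cancel (sigma g^-1%g) (sigma g).
Proof. by move=> a; rewrite -sigmaM mulgV sigma1E. Qed.

Lemma coeff_skewMU x b k h :
  (x * (<< b *g k >> : S))@_h = x@_(h * k^-1)%g * sigma (h * k^-1)%g b.
Proof.
rewrite [in LHS](skewE x) mulr_suml raddf_sum /=.
under eq_bigr => g _ do rewrite skewM_UU mcoeffU.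
have [hk|hk] := boolP ((h * k^-1)%g \in msupp x).
  rewrite (bigD1_seq _ hk) ?fset_uniq //= mulgVK eqxx big1 ?addr0 // => g gh.
  by case: (_ =P h) gh => // <-; rewrite mulgK eqxx.
rewrite (mcoeff_outdom hk) mul0r big_seq big1 // => g gx.
by case: eqP hk => // <-; rewrite mulgK gx.
Qed.

Lemma coeff_skewUM x a k h :
  ((<< a *g k >> : S) * x)@_h = a * sigma k x@_(k^-1 * h)%g.
Proof.
rewrite [in LHS](skewE x) mulr_sumr raddf_sum /=.
under eq_bigr => g _ do rewrite skewM_UU mcoeffU.
have [hk|hk] := boolP ((k^-1 * h)%g \in msupp x).
  rewrite (bigD1_seq _ hk) ?fset_uniq //= mulVKg eqxx big1 ?addr0 // => g gh.
  by case: (_ =P h) gh => // <-; rewrite mulKg eqxx.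
rewrite (mcoeff_outdom hk) rmorph0 mulr0 big_seq big1 // => g gx.
by case: eqP hk => // <-; rewrite mulKg gx.
Qed.

(** Monomials span, so absorption needs to be tested on them only; there the
    product has the explicit coefficients above. *)
Lemma skew_monomials_ideal (I : set S) :
  I 0 -> (forall x y, I x -> I y -> I (x - y)) ->
  (forall a g x, I x -> I ((<< a *g g >> : S) * x) /\
                        I (x * (<< a *g g >> : S))) ->
  ideal I.
Proof.
move=> I0 IB IM.
have ID x y : I x -> I y -> I (x + y).
  by move=> Ix Iy; rewrite -[y]opprK -[- y]sub0r; apply/IB => //; apply/IB.
split=> // a x Ix; rewrite (skewE a) mulr_suml mulr_sumr.
by split; apply: big_ind => // g _; case: (IM a@_g g x Ix).
Qed.

Lemma skew_centralP z :
  (forall a, z * (<< a *g 1%g >> : S) = (<< a *g 1%g >> : S) * z) ->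
  (forall h, z * (<< 1 *g h >> : S) = (<< 1 *g h >> : S) * z) ->
  forall x, z * x = x * z.
Proof.
move=> za zu x; rewrite (skewE x) mulr_suml mulr_sumr; apply: eq_bigr => g _.
have -> : << x@_g *g g >> = (<< x@_g *g 1%g >> : S) * << 1 *g g >>.
  by rewrite skewM_UU rmorph1 mulr1 mul1g.
by rewrite mulrA za -mulrA zu mulrA.
Qed.

(** Compares the coefficients at gh in z u_h = u_h z. *)
Lemma central_coeff_conj z : (forall x, z * x = x * z) ->
  forall g h, sigma h z@_(g ^ h)%g = z@_g.
Proof.
move=> zC g h; have := congr1 (mcoeff (g * h)%g) (zC (<< 1 *g h >>)).
by rewrite coeff_skewMU coeff_skewUM mulgK rmorph1 mulr1 mul1r conjgE => <-.
Qed.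

(** Compares the coefficients at g in z a = a z. *)
Lemma central_coeff_twist z : (forall x, z * x = x * z) ->
  forall g a, a * z@_g = z@_g * sigma g a.
Proof.
move=> zC g a; have := congr1 (mcoeff g) (zC (<< a *g 1%g >>)).
by rewrite coeff_skewMU coeff_skewUM sigma1E invg1 mulg1 mul1g => <-.
Qed.

(** * Consequences of G-simplicity *)

(** The multiples of c form a G-invariant ideal. *)
Lemma G_simple_inverse c : G_simple sigma ->
  (forall a, c * a = a * c) -> (forall g, sigma g c = c) -> c <> 0 ->
  exists b, c * b = 1.
Proof.
move=> Gsimp cC cfix c0.
have inv : G_invariant sigma [set a | exists b, a = c * b].
  by move=> g _ [_ [b ->] <-]; exists (sigma g b); rewrite rmorphM /= cfix.
have [J0|JT] := Gsimp _ (multiples_ideal cC) inv.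
  suff : [set a | exists b, a = c * b] c by rewrite J0.
  by exists 1; rewrite mulr1.
have : [set a | exists b, a = c * b] 1 by rewrite JT.
by case=> b ->; exists b.
Qed.

(** A G-invariant ideal I of A extends to the ideal of S of the elements with
    all coefficients in I, which remembers I. *)
Lemma simple_skew_G_simple : simple_ring S -> G_simple sigma.
Proof.
move=> [_ simp] I idI inv; have [I0 IB _] := idI.
have sI g a : I a -> I (sigma g a) by move=> Ia; apply: (inv g); exists a.
pose J : set S := [set x | forall g, I x@_g].
have idJ : ideal J.
  apply: skew_monomials_ideal => [g|x y Jx Jy g|a k x Jx].
  - by rewrite mcoeff0.
  - by rewrite mcoeffB; apply: IB.
  split=> g; rewrite ?coeff_skewUM ?coeff_skewMU.
    exact/(idealMl _ idI)/sI/Jx.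
  exact/(idealMr _ idI)/Jx.
have [J0|JT] := simp J idJ; [left|right].
  apply/seteqP; split=> [a Ia|_ -> //].
  have : J (<< a *g 1%g >>) by move=> g; rewrite mcoeffU; case: eqP.
  by rewrite J0 => /= /eqP; rewrite monalgU_eq0 => /eqP.
apply: ideal1_setT => //; have : J 1 by rewrite JT.
by move/(_ 1%g); rewrite skew1E mcoeffUU.
Qed.

(** The engine of both converses: in a nonzero ideal, an element of minimal
    support, normalised to have a coefficient 1, is central up to a factor
    u_g, because each of its commutators has smaller support. *)
Lemma abelian_ideal_central (J : set S) :
  (forall g h, (g * h = h * g)%g) -> G_simple sigma ->
  ideal J -> J <> [set 0] ->
  exists y, [/\ J y, forall x, y * x = x * y & y@_1%g = 1].
Proof.
move=> GC Gsimp idJ Jn0; have [J0 JB _] := idJ.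
have [x0 Jx0 x0n] := ideal_neq0P idJ Jn0.
have exn : exists n, `[< exists x, [/\ J x, x <> 0 & #|` msupp x| = n] >].
  by exists #|` msupp x0|; apply/asboolP; exists x0.
case: (ex_minnP exn) => n /asboolP[x [Jx xn0 xn]] {exn x0 Jx0 x0n}minx.
have [g xg] : exists g, g \in msupp x.
  suff /fset0Pn : msupp x != fset0 by [].
  by apply/eqP=> e; apply: xn0; rewrite (skewE x) e big_seq_fset0.
(* The elements of J supported in the support of x. *)
pose L : set S := [set y | J y /\ fsubset (msupp y) (msupp x)].
have LP y : J y -> (forall h, x@_h = 0 -> y@_h = 0) -> L y.
  move=> Jy yx; split=> //; apply/fsubsetP=> h; rewrite -!mcoeff_neq0.
  by apply: contraNN => /eqP /yx ->.
have L0 y h : L y -> x@_h = 0 -> y@_h = 0.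
  move=> [_ /fsubsetP yx] /eqP; rewrite mcoeff_eq0 => hx; apply: mcoeff_outdom.
  by apply: contraNN hx; apply: yx.
(* Losing the coefficient at g makes the support strictly smaller. *)
have Lmin y : L y -> y@_g = 0 -> y = 0.
  move=> [Jy yx] yg; apply: contrapT => y0.
  have /minx : `[< exists z, [/\ J z, z <> 0 & #|` msupp z| = #|` msupp y|] >].
    by apply/asboolP; exists y.
  rewrite -xn leqNgt => /negP; apply; apply: fproper_ltn_card.
  rewrite fproperEneq yx andbT; apply/eqP=> e.
  by move: xg; rewrite -e -mcoeff_neq0 yg eqxx.
have conjE h y k : ((<< 1 *g h >> : S) * y * (<< 1 *g h^-1%g >> : S))@_k =
    sigma h y@_k.
  rewrite coeff_skewMU coeff_skewUM rmorph1 mulr1 mul1r invgK.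
  by rewrite (GC k) mulKg.
have LB y z : L y -> L z -> L (y - z).
  move=> Ly Lz; apply: LP => [|h xh].
    by case: Ly Lz => ? _ [? _]; apply: JB.
  by rewrite mcoeffB (L0 y) // (L0 z) // subrr.
have LM a y : L y ->
    L ((<< a *g 1%g >> : S) * y) /\ L (y * (<< a *g 1%g >> : S)).
  move=> Ly; have aJ := idealMl (<< a *g 1%g >> : S) idJ Ly.1.
  have Ja := idealMr (<< a *g 1%g >> : S) idJ Ly.1.
  split; apply: LP => // h xh; rewrite ?coeff_skewUM ?coeff_skewMU.
    by rewrite invg1 mul1g (L0 y) // rmorph0 mulr0.
  by rewrite invg1 mulg1 (L0 y) // mul0r.
have Lconj h y : L y -> L ((<< 1 *g h >> : S) * y * (<< 1 *g h^-1%g >> : S)).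
  move=> Ly; apply: LP => [|k xk].
    exact/(idealMr _ idJ)/(idealMl _ idJ)/Ly.1.
  by rewrite conjE (L0 y) // rmorph0.
pose I : set A := [set y@_g | y in L].
have idI : ideal I.
  split.
  - by exists 0; [split; rewrite ?msupp0 ?fsub0set | rewrite mcoeff0].
  - move=> _ _ [y Ly <-] [z Lz <-]; exists (y - z); last by rewrite mcoeffB.
    exact: LB.
  move=> a _ [y Ly <-]; split.
    exists ((<< a *g 1%g >> : S) * y); first exact: (LM a y Ly).1.
    by rewrite coeff_skewUM invg1 mul1g sigma1E.
  (* Right multiplication by a twists the coefficient at g by sigma_g. *)
  exists (y * (<< sigma g^-1%g a *g 1%g >> : S));
    first exact: (LM _ y Ly).2.
  by rewrite coeff_skewMU invg1 mulg1 sigmaVK.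
have invI : G_invariant sigma I.
  move=> h _ [_ [y Ly <-] <-].
  by exists ((<< 1 *g h >> : S) * y * (<< 1 *g h^-1%g >> : S));
    [apply: Lconj | rewrite conjE].
have [I0|IT] := Gsimp I idI invI.
  have : I x@_g by exists x; [split=> //; exact: fsubset_refl|].
  by rewrite I0 => /= xg0; move: xg; rewrite -mcoeff_neq0 xg0 eqxx.
have [y Ly yg] : I 1 by rewrite IT.
(* Twisted commutation with A: the twist compensates for the factor u_g^-1
   that moves the coefficient 1 from g to the identity. *)
have ya a : (<< a *g 1%g >> : S) * y = y * (<< sigma g^-1%g a *g 1%g >> : S).
  apply/eqP; rewrite -subr_eq0; apply/eqP/Lmin.
    by apply: LB; [exact: (LM a y Ly).1 | exact: (LM _ y Ly).2].
  rewrite mcoeffB coeff_skewUM coeff_skewMU invg1 mulg1 mul1g sigmaVK sigma1E.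
  by rewrite yg mulr1 mul1r subrr.
have yu h : (<< 1 *g h >> : S) * y * (<< 1 *g h^-1%g >> : S) = y.
  apply/eqP; rewrite -subr_eq0; apply/eqP/Lmin.
    exact: LB (Lconj _ _ Ly) Ly.
  by rewrite mcoeffB conjE yg rmorph1 subrr.
pose u k : S := << 1 *g k >>.
exists (y * u g^-1%g); split.
- exact/(idealMr _ idJ)/Ly.1.
- apply: skew_centralP => [a|h]; rewrite [in RHS]mulrA.
    rewrite ya -!mulrA !skewM_UU rmorph1 mulr1 mul1r mulg1.
    by rewrite mul1g.
  have <- : y * u h = u h * y.
    by rewrite -[in LHS](yu h) -!mulrA !skewM_UU rmorph1 mulr1 mulVg mulr1.
  by rewrite -!mulrA !skewM_UU !rmorph1 GC.
by rewrite coeff_skewMU invgK mul1g yg rmorph1 mulr1.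
Qed.

(** A central element with coefficient 1 at the identity is nonzero, hence
    invertible as soon as the centre is a field. *)
Lemma abelian_simple :
  (forall g h, (g * h = h * g)%g) -> G_simple sigma ->
  is_field (centre S) -> simple_ring S.
Proof.
move=> GC Gsimp ZF; split; first exact/eqP/oner_neq0.
move=> J idJ; have [->|Jn0] := pselect (J = [set 0]); [by left|right].
have [y [Jy yC y1]] := abelian_ideal_central GC Gsimp idJ Jn0.
have [|z yz] := centre_inverse ZF yC.
  move=> y0; move/eqP: y1; rewrite y0 mcoeff0 eq_sym; exact/negP/oner_neq0.
apply: ideal1_setT => //; rewrite -yz; exact: idealMr.
Qed.

(** The central element produced by minimality is 1: a nonzero coefficient at h
    is sigma-fixed, hence invertible, and then intertwines the identity and
    sigma_h on the commutative ring A, so that sigma_h = 1. *)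
Lemma abelian_commutative_simple :
  (forall g h, (g * h = h * g)%g) -> (forall a b, a * b = b * a) ->
  G_simple sigma -> injective sigma -> simple_ring S.
Proof.
move=> GC AC Gsimp sI; split; first exact/eqP/oner_neq0.
move=> J idJ; have [->|Jn0] := pselect (J = [set 0]); [by left|right].
have [y [Jy yC y1]] := abelian_ideal_central GC Gsimp idJ Jn0.
suff y1E : y = 1 by apply: ideal1_setT => //; rewrite -y1E.
rewrite skew1E; apply/malgP=> h; rewrite mcoeffU; case: eqP => [<- //|h1].
apply: contrapT => yh; have [|b yb] := G_simple_inverse Gsimp (AC _) _ yh.
  move=> k; rewrite -{2}(central_coeff_conj yC h k).
  by rewrite conjgE GC -mulgA mulgV mulg1.
apply: h1; apply: sI; apply: ring_autP => a; rewrite sigma1E.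
have := central_coeff_twist yC h a; rewrite AC.
by move/(congr1 ( *%R b)); rewrite !mulrA (AC b) yb !mul1r.
Qed.

(** * Groups with infinite conjugacy classes *)

(** The support of a central element is finite and stable under conjugation,
    so it is contained in {1}; the remaining coefficient is a sigma-fixed
    central element of A. *)
Lemma icc_centre_field :
  (forall g, g <> 1%g -> infinite_set (range (fun h => (g ^ h)%g))) ->
  G_simple sigma -> is_field (centre S).
Proof.
move=> icc Gsimp; apply: centre_is_field; first exact/eqP/oner_neq0.
move=> z zC z0.
have z1E : z = << z@_1%g *g 1%g >>.
  apply/malgP=> g; rewrite mcoeffU; case: eqP => [<- //|g1].
  apply: contrapT => zg; apply: (icc g); first by move=> e; apply: g1.
  apply: sub_finite_set (finite_fset (msupp z)) => _ [h _ <-] /=.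
  rewrite -mcoeff_neq0; apply/eqP=> zgh; apply: zg.
  by rewrite -(central_coeff_conj zC g h) zgh rmorph0.
have [||| b zb] := @G_simple_inverse z@_1%g Gsimp.
- by move=> a; rewrite [RHS](central_coeff_twist zC) sigma1E.
- by move=> g; rewrite -[RHS](central_coeff_conj zC _ g) conj1g.
- by move=> e; apply: z0; rewrite z1E e monalgU0.
exists (<< b *g 1%g >>).
by rewrite z1E skewM_UU sigma1E zb mulg1.
Qed.

(** * Modules over a skew group ring *)

(** An S-module is an A-module with an action of G by sigma-semilinear maps. *)
Section CovariantModule.
Variables (M : lmodType A) (tau : G -> {additive M -> M}).
Hypothesis tau1 : forall v, tau 1%g v = v.
Hypothesis tauM : forall g h v, tau (g * h)%g v = tau g (tau h v).
Hypothesis tauZ : forall g a v, tau g (a *: v) = sigma g a *: tau g v.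

Definition skew_act x (v : M) : M := \sum_(g <- msupp x) x@_g *: tau g v.

Lemma skew_actw (d : {fset G}) x v :
  fsubset (msupp x) d -> skew_act x v = \sum_(g <- d) x@_g *: tau g v.
Proof.
move=> le; rewrite /skew_act (big_fset_incl _ le) // => g _ /mcoeff_outdom ->.
by rewrite scale0r.
Qed.

Lemma skew_actU a g v : skew_act << a *g g >> v = a *: tau g v.
Proof. by rewrite (skew_actw _ msuppU_le) big_seq_fset1 mcoeffUU. Qed.

Lemma skew_actB x y v : skew_act (x - y) v = skew_act x v - skew_act y v.
Proof.
rewrite (skew_actw _ (msuppB_le x y)).
rewrite (skew_actw _ (fsubsetUl (msupp x) (msupp y))).
rewrite (skew_actw _ (fsubsetUr (msupp x) (msupp y))) -sumrB.
by apply: eq_bigr => g _; rewrite mcoeffB scalerBl.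
Qed.

Lemma skew_act0 v : skew_act 0 v = 0.
Proof. by rewrite -(subrr 0) skew_actB subrr. Qed.

Lemma skew_actr0 x : skew_act x 0 = 0.
Proof. by rewrite /skew_act big1 // => g _; rewrite raddf0 scaler0. Qed.

Lemma skew_act_sum (I : Type) (r : seq I) (F : I -> S) v :
  skew_act (\sum_(i <- r) F i) v = \sum_(i <- r) skew_act (F i) v.
Proof.
apply: (big_morph (skew_act^~ v)) => [x y|]; last exact: skew_act0.
by rewrite -{1}[y]opprK skew_actB -sub0r skew_actB skew_act0 sub0r opprK.
Qed.

Lemma skew_actM x y v : skew_act (x * y) v = skew_act x (skew_act y v).
Proof.
rewrite [in LHS](skewE x) mulr_suml skew_act_sum; apply: eq_bigr => g _.
rewrite {1}(skewE y) mulr_sumr skew_act_sum raddf_sum scaler_sumr.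
apply: eq_bigr => h _ /=.
by rewrite skewM_UU skew_actU tauM tauZ scalerA.
Qed.

Lemma annihilator_ideal : ideal [set x | forall v, skew_act x v = 0].
Proof.
split=> [v|x y x0 y0 v|a x x0]; first exact: skew_act0.
  by rewrite skew_actB x0 y0 subrr.
by split=> v; rewrite skew_actM ?x0 ?skew_actr0.
Qed.

Lemma simple_skew_faithful x : simple_ring S ->
  (exists v : M, v <> 0) -> (forall v, skew_act x v = 0) -> x = 0.
Proof.
move=> [_ simp] [v v0] x0; have [J0|JT] := simp _ annihilator_ideal.
  suff : [set x | forall v, skew_act x v = 0] x by rewrite J0.
  exact: x0.
case: v0; have : [set x | forall v, skew_act x v = 0] 1 by rewrite JT.
by move/(_ v); rewrite skew1E skew_actU tau1 scale1r.
Qed.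

End CovariantModule.

(** On the module A with u_g acting as sigma_g, the element u_g - u_h acts as
    zero when sigma_g = sigma_h. *)
Lemma simple_skew_injective : simple_ring S -> injective sigma.
Proof.
move=> simp g h gh.
pose tau k : {additive A^o -> A^o} := sigma k.
have z0 : (<< 1 *g g >> - << 1 *g h >> : S) = 0.
  apply: (@simple_skew_faithful A^o tau) => //.
  - exact: sigma1E.
  - exact: sigmaM.
  - by move=> k a v; rewrite /tau /= rmorphM.
  - by exists 1; apply/eqP/oner_neq0.
  - by move=> v; rewrite skew_actB !skew_actU /tau /= gh subrr.
move/(congr1 (mcoeff g)): z0; rewrite mcoeffB mcoeffUU mcoeffU mcoeff0.
by case: eqP => [-> //|_]; rewrite subr0 => /eqP; rewrite oner_eq0.
Qed.

(** On the module A with u_g acting as left multiplication by rho g, the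
    nonzero element rho(g^-1) u_g - 1 acts as zero. *)
Lemma inner_not_simple (rho : G -> A) :
  rho 1%g = 1 -> (forall g h, rho (g * h)%g = rho g * rho h) ->
  (forall g a, rho g * a = sigma g a * rho g) ->
  (exists g : G, g <> 1%g) -> ~ simple_ring S.
Proof.
move=> rho1 rhoM rhoC [g g1] simp.
pose tau k : {additive A^o -> A^o} := rho k \*o idfun.
have z0 : (<< rho g^-1%g *g g >> - << 1 *g 1%g >> : S) = 0.
  apply: (@simple_skew_faithful A^o tau) => //.
  - by move=> v; rewrite /tau /= rho1 mul1r.
  - by move=> k h v; rewrite /tau /= rhoM mulrA.
  - by move=> k a v; rewrite /tau /GRing.scale /= mulrA rhoC mulrA.
  - by exists 1; apply/eqP/oner_neq0.
  - move=> v; rewrite skew_actB !skew_actU /tau /= rho1 /GRing.scale /=.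
    by rewrite mulrA -rhoM mulVg rho1 !mul1r subrr.
move/(congr1 (mcoeff 1%g)): z0; rewrite mcoeffB mcoeffUU mcoeffU mcoeff0.
by case: eqP => // _ /eqP; rewrite sub0r oppr_eq0 oner_eq0.
Qed.

End SkewCoefficients.

(** * Actions by inner automorphisms *)

Section InnerAction.
Variables (A : nzRingType) (G : groupType) (rho : G -> A).
Hypothesis rho1 : rho 1%g = 1.
Hypothesis rhoM : forall g h, rho (g * h)%g = rho g * rho h.

Lemma rhoKr g : rho g * rho g^-1%g = 1.
Proof. by rewrite -rhoM mulgV. Qed.

Lemma rhoKl g : rho g^-1%g * rho g = 1.
Proof. by rewrite -rhoM mulVg. Qed.

Lemma inner_ring_aut g : ring_aut_pred (fun a => rho g * a * rho g^-1%g).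
Proof.
split.
- by move=> a b; rewrite mulrBr mulrBl.
- split=> [|a b]; first by rewrite mulr1 rhoKr.
  by rewrite !mulrA -(mulrA _ _ (rho g)) rhoKl mulr1.
exists (fun a => rho g^-1%g * a * rho g) => a.
  by rewrite !mulrA rhoKl mul1r -mulrA rhoKl mulr1.
by rewrite !mulrA rhoKr mul1r -mulrA rhoKr mulr1.
Qed.

Definition inner g : ring_aut A := RingAut (asboolT (inner_ring_aut g)).

Lemma inner_monoid_morphism : monoid.monoid_morphism inner.
Proof.
split=> [|g h]; apply: ring_autP => a /=.
  by rewrite invg1 rho1 mul1r mulr1.
by rewrite invgM !rhoM !mulrA.
Qed.

HB.instance Definition _ :=
  isUMagmaMorphism.Build G (ring_aut A) inner inner_monoid_morphism.

Definition inner_action : group_hom G (ring_aut A) := inner.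

Lemma inner_actionE g a : rho g * a = inner_action g a * rho g.
Proof. by rewrite /= -!mulrA rhoKl mulr1. Qed.

End InnerAction.

(** * Simplicity of matrix rings *)

(** A nonzero entry of a matrix in the ideal is moved by matrix units to every
    diagonal position, and these pieces add up to the identity. *)
Lemma matrix_ring_ideal (F : fieldType) n (I : set 'M[F]_n.+1) :
  ideal I -> I = [set 0] \/ I = setT.
Proof.
move=> idI; have [|In0] := pselect (I = [set 0]); [by left|right].
have [M IM M0] := ideal_neq0P idI In0.
have [i [j Mij]] : exists i j, M i j != 0.
  apply: contrapT => noM; apply: M0; apply/matrixP=> i j; rewrite mxE.
  by apply: contrapT => /eqP Mij; apply: noM; exists i, j.
apply: ideal1_setT => //.
have unitE k :
    delta_mx k i * M * delta_mx j k = M i j *: delta_mx k k :> 'M[F]_n.+1.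
  rewrite -[LHS]/(_ *m _ *m _).
  rewrite -(mul_delta_mx (0 : 'I_1) k i) -(mul_delta_mx (0 : 'I_1) j k).
  rewrite -!mulmxA (mulmxA M) -colE (mulmxA (delta_mx 0 i)) -rowE.
  by rewrite [row i _]mx11_scalar !mxE mul_scalar_mx -scalemxAr mul_delta_mx.
have oneE : 1%:M =
    \sum_k ((M i j)^-1)%:M * (delta_mx k i * M * delta_mx j k).
  rewrite mx1_sum_delta; apply: eq_bigr => k _.
  by rewrite unitE -[RHS]/(_ *m _) mul_scalar_mx scalerA mulVf // scale1r.
rewrite -[X in I X]/(1%:M : 'M[F]_n.+1) oneE.
apply: ideal_sum => // k; apply: idealMl => //.
by apply: idealMr => //; apply: idealMl.
Qed.

(** * The affine group of the rational line *)

(** The pair (a, b) stands for the map x |-> a x + b. *)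
Definition affine : Type := {p : rat * rat | p.1 != 0}.
HB.instance Definition _ := Choice.on affine.

Section Affine.
Implicit Types p q : affine.
Definition slope p := (val p).1.
Definition shift p := (val p).2.

Lemma affineP p q : slope p = slope q -> shift p = shift q -> p = q.
Proof.
move=> e1 e2; apply: val_inj.
by rewrite [LHS]surjective_pairing [RHS]surjective_pairing; congr pair.
Qed.

Lemma slope_neq0 p : slope p != 0.
Proof. exact: (valP p). Qed.

Definition mk_affine a b (a0 : a != 0) : affine := exist _ (a, b) a0.

Definition affine_one := mk_affine 0 (oner_neq0 rat).
Definition affine_mul p q :=
  mk_affine (slope p * shift q + shift p)
    (mulf_neq0 (slope_neq0 p) (slope_neq0 q)).
Definition affine_inv p :=
  mk_affine (- (shift p / slope p)) (invr_neq0 (slope_neq0 p)).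

Let slope_mul p q : slope (affine_mul p q) = slope p * slope q.
Proof. by []. Qed.
Let shift_mul p q : shift (affine_mul p q) = slope p * shift q + shift p.
Proof. by []. Qed.
Let slope_one : slope affine_one = 1. Proof. by []. Qed.
Let shift_one : shift affine_one = 0. Proof. by []. Qed.
Let slope_inv p : slope (affine_inv p) = (slope p)^-1. Proof. by []. Qed.
Let shift_inv p : shift (affine_inv p) = - (shift p / slope p).
Proof. by []. Qed.
Let affE :=
  (slope_mul, shift_mul, slope_one, shift_one, slope_inv, shift_inv).

Lemma affine_mulA : associative affine_mul.
Proof. by move=> p q r; apply: affineP; rewrite !affE; ring. Qed.

Lemma affine_mul1 : left_id affine_one affine_mul.
Proof. by move=> p; apply: affineP; rewrite !affE; ring. Qed.

Lemma affine_mulr1 : right_id affine_one affine_mul.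
Proof. by move=> p; apply: affineP; rewrite !affE; ring. Qed.

Lemma affine_mulV : left_inverse affine_one affine_inv affine_mul.
Proof.
by move=> p; have p0 := slope_neq0 p; apply: affineP; rewrite !affE; field.
Qed.

Lemma affine_mulrV : right_inverse affine_one affine_inv affine_mul.
Proof.
by move=> p; have p0 := slope_neq0 p; apply: affineP; rewrite !affE; field.
Qed.

HB.instance Definition _ := isGroup.Build affine
  affine_mulA affine_mul1 affine_mulr1 affine_mulV affine_mulrV.

Lemma shiftJ p q :
  shift (p ^ q)%g = (shift p + (slope p - 1) * shift q) / slope q.
Proof.
have q0 := slope_neq0 q.
rewrite -[(p ^ q)%g]/(affine_mul (affine_inv q) (affine_mul p q)) !affE.
by field.
Qed.

(** A nontrivial translation is rescaled by the homotheties, and the shift of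
    any other element is moved by the translations; it is enough to watch the
    shift along a sequence of such conjugators. *)
Lemma affine_icc p : p <> 1%g -> infinite_set (range (fun q => (p ^ q)%g)).
Proof.
move=> p1 fin.
suff [f fI] : exists f : nat -> affine, injective (fun n => shift (p ^ f n)%g).
  apply: infinite_nat.
  apply: sub_finite_set (finite_preimage (f := fun n => (p ^ f n)%g) _ fin).
    by move=> n _; exists (f n).
  by move=> m n _ _ e; apply: fI; rewrite e.
have [a1|a1] := eqVneq (slope p) 1.
  have b0 : shift p != 0.
    by apply/eqP=> b0; apply: p1; apply: affineP.
  have nz n : (n.+1%:R : rat)^-1 != 0 by rewrite invr_eq0 pnatr_eq0.
  (* Conjugation by slope 1/(n+1) multiplies the shift by n+1. *)
  exists (fun n => mk_affine 0 (nz n)) => m n.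
  rewrite !shiftJ a1 subrr !mul0r !addr0 /slope /= !invrK => /(mulfI b0) /eqP.
  by rewrite eqr_nat eqSS => /eqP.
exists (fun n => mk_affine n%:R (oner_neq0 rat)) => m n.
rewrite !shiftJ /slope /shift /= !divr1 => /addrI /mulfI; rewrite subr_eq0.
by move=> /(_ a1) /eqP; rewrite eqr_nat => /eqP.
Qed.

(** The dimension is written 1 + 1 so that block computation applies. *)
Definition affine_mx p : 'M[rat]_(1 + 1) :=
  block_mx (slope p)%:M (shift p)%:M 0 1%:M.

Lemma affine_mx1 : affine_mx 1%g = 1.
Proof. by rewrite /affine_mx slope_one shift_one raddf0 -scalar_mx_block. Qed.

Lemma affine_mxM p q : affine_mx (p * q)%g = affine_mx p * affine_mx q.
Proof.
rewrite -[RHS]/(_ *m _) mulmx_block /affine_mx slope_mul shift_mul.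
by rewrite !(mulmx0, mul0mx, addr0, add0r, mulmx1) raddfD /= !scalar_mxM.
Qed.

(** Commuting with the lower left matrix unit alone forces slope 1 and shift 0. *)
Lemma affine_action_injective : injective (inner_action affine_mx1 affine_mxM).
Proof.
apply: gmulf_inj => p e.
pose E : 'M[rat]_(1 + 1) := block_mx 0 0 1%:M 0.
have : affine_mx p *m E = E *m affine_mx p.
  by have := inner_actionE affine_mx1 affine_mxM p E; rewrite e.
rewrite /affine_mx /E !mulmx_block.
rewrite !(mulmx0, mul0mx, addr0, add0r, mulmx1, mul1mx).
move=> /eq_block_mx[b0 _ a1 _]; apply: affineP.
  by have /matrixP/(_ 0 0) := a1; rewrite !mxE /=.
by have /matrixP/(_ 0 0) := b0; rewrite !mxE /=.
Qed.

End Affine.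

Theorem theorem1p2 :
  (* (a) *)
  (forall (A : nzRingType) (G : groupType) (sigma : group_hom G (ring_aut A)),
     simple_ring (skew_group_ring sigma) ->
     (G_simple sigma /\ is_field (centre (skew_group_ring sigma))) /\
     (G_simple sigma /\ injective sigma)) /\
  (* (b) *)
  (exists (A : nzRingType) (G : groupType) (sigma : group_hom G (ring_aut A)),
     (G_simple sigma /\ is_field (centre (skew_group_ring sigma))) /\
     (G_simple sigma /\ injective sigma) /\
     ~ simple_ring (skew_group_ring sigma)) /\
  (* (c) *)
  (forall (A : nzRingType) (G : groupType) (sigma : group_hom G (ring_aut A)),
     (forall g h : G, (g * h = h * g)%g) ->
     (simple_ring (skew_group_ring sigma) <->
      G_simple sigma /\ is_field (centre (skew_group_ring sigma)))) /\
  (* (d) *)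
  (forall (A : nzRingType) (G : groupType) (sigma : group_hom G (ring_aut A)),
     (forall g h : G, (g * h = h * g)%g) ->
     (forall a b : A, (a * b = b * a)%R) ->
     (simple_ring (skew_group_ring sigma) <->
      G_simple sigma /\ is_field (centre (skew_group_ring sigma))) /\
     (simple_ring (skew_group_ring sigma) <->
      G_simple sigma /\ injective sigma)).
Proof.
have simple_field (A : nzRingType) (G : groupType)
    (sigma : group_hom G (ring_aut A)) :
    simple_ring (skew_group_ring sigma) ->
    G_simple sigma /\ is_field (centre (skew_group_ring sigma)).
  move=> simp.
  by split; [exact: simple_skew_G_simple | exact: simple_centre_field].
have simple_inj (A : nzRingType) (G : groupType)
    (sigma : group_hom G (ring_aut A)) :
    simple_ring (skew_group_ring sigma) -> G_simple sigma /\ injective sigma.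
  move=> simp.
  by split; [exact: simple_skew_G_simple | exact: simple_skew_injective].
split; first by move=> A G sigma simp; split; auto.
split.
  pose sigma := inner_action affine_mx1 affine_mxM.
  exists 'M[rat]_(1 + 1), affine, sigma.
  have Gsimp : G_simple sigma by move=> I idI _; exact: matrix_ring_ideal.
  split; first by split=> //; exact: icc_centre_field affine_icc Gsimp.
  split; first by split=> //; exact: affine_action_injective.
  apply: (inner_not_simple affine_mx1 affine_mxM); first exact: inner_actionE.
  by exists (mk_affine 1 (oner_neq0 rat)) => /(congr1 shift).
have field_simple (A : nzRingType) (G : groupType)
    (sigma : group_hom G (ring_aut A)) :
    (forall g h : G, (g * h = h * g)%g) ->
    (simple_ring (skew_group_ring sigma) <->
     G_simple sigma /\ is_field (centre (skew_group_ring sigma))).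
  by move=> GC; split=> [/simple_field //|[]]; exact: abelian_simple.
split=> // A G sigma GC AC; split; first exact: field_simple.
by split=> [/simple_inj //|[]]; exact: abelian_commutative_simple.
Qed.
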